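(* Consider the halfspace-chasing algorithm with parameter $\epsilon\in(0,1]$ described in the context. Its total upward recourse $\sum_{t=1}^T\sum_{i=1}^n w_i(x_i^t-x_i^{t-1})_+$ is at most $O\!\left(\frac{1}{\epsilon}\log\frac{d}{\epsilon}\right)$ times the optimal value of the linear program $(\overline{\mathcal D})$.
   Context: Variables $x\in\mathbb{R}^n_+$, weights $w\in\mathbb{R}^n_{+}$. At times $t=1,\dots,T$ a single constraint arrives: for $t\in C$ a covering constraint $\langle c^t,x\rangle\ge 1$, for $t\in P$ a packing constraint $\langle p^t,x\rangle\le 1$, with $c^t,p^t\in\mathbb{R}^n_{\ge0}$ ($C\cup P=\{1,\dots,T\}$ disjoint). Let $d^t=|\{i:c_i^t\neq 0\}|$, $d=\max_t d^t$. Write $a_+=\max(0,a)$. Algorithm (parameter $\epsilon$): $x^0=0$. It is assumed each arriving constraint is violated by $x^{t-1}$ (for packing: $\langle p^t,x^{t-1}\rangle>1+\epsilon$). For $t\in C$, coordinates with $c_i^t=0$ are unchanged, and the others are set to the minimizer of $\sum_{i:c_i^t\ne0} w_i[\hat x_i\log(\hat x_i/\hat x_i^{t-1})-\hat x_i]$ subject to $\langle c^t,x\rangle\ge1$, where $\hat x_i=x_i+\frac{\epsilon}{4d^tc_i^t}$ and $\hat x_i^{t-1}=x_i^{t-1}+\frac{\epsilon}{4d^tc_i^t}$. For $t\in P$, coordinates with $p_i^t=0$ are unchanged, and the others are set to the minimizer of $\sum_{i:p_i^t\ne0}w_i(x_i\log(x_i/x_i^{t-1})-x_i)$ subject to $\langle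 p^t,x\rangle\le 1+\epsilon$. The linear program $(\overline{\mathcal D})$: maximize $\sum_{t\in C}\bar y^t-\sum_{t\in P}\bar z^t$ over $\bar y^t,\bar z^t\ge0$ and $\bar r_i^t$ ($t=1,\dots,T+1$) subject to $c_i^t\bar y^t-\bar r_i^t+\bar r_i^{t+1}\le0$ for all $i$, $t\in C$; $-p_i^t\bar z^t-\bar r_i^t+\bar r_i^{t+1}\le 0$ for all $i$, $t\in P$; and $0\le \bar r_i^t\le w_i$. It is the LP dual of: minimize $\sum_t\sum_i w_i\bar\ell_i^t$ subject to $\langle c^t,\bar x^t\rangle\ge1$ ($t\in C$), $\langle p^t,\bar x^t\rangle\le1$ ($t\in P$), $\bar x_i^t-\bar x_i^{t-1}\le\bar\ell_i^t$, $\bar x,\bar\ell\ge0$.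
   Formalization: The bound is proved as a universal constant times (1/ε)(1 + log(d/ε)), since the literal log(d/ε) is 0 at d = ε = 1, where the recourse can be positive; for d/ε ≥ 2 this is O((1/ε) log(d/ε)). *)

(* Defs.v *)
From HB Require Import structures.
From mathcomp Require Import all_boot all_order all_algebra.
From mathcomp Require Import all_classical all_reals all_analysis.

Set Implicit Arguments.
Unset Strict Implicit.
Unset Printing Implicit Defensive.

Import Order.TTheory GRing.Theory Num.Theory.

Local Open Scope classical_set_scope.
Local Open Scope ring_scope.

Section HalfspaceChasing.
Context {R : realType} {n : nat}.

Definition vec := 'I_n -> R.

Definition dot (u v : vec) : R := \sum_i u i * v i.

Definition nonneg (u : vec) : Prop := forall i, 0 <= u i.

(* Times are natural numbers, and only the times 1, ..., T are meaningful;
   [ccoef t] is only used for [t] in C and [pcoef t] for [t] in P. *)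
Record instance := Instance {
  horizon : nat;
  weight : vec;
  isC : pred nat;
  isP : pred nat;
  ccoef : nat -> vec;
  pcoef : nat -> vec }.

Definition is_time (I : instance) (t : nat) : bool := (1 <= t <= horizon I)%N.

Definition wf_instance (I : instance) : Prop :=
  [/\ nonneg (weight I),
      forall t, is_time I t -> isP I t = ~~ isC I t,
      forall t, is_time I t -> isC I t -> nonneg (ccoef I t)
    & forall t, is_time I t -> isP I t -> nonneg (pcoef I t)].

Definition sparsity (c : vec) : nat := #|[set i | c i != 0]%SET|.

Definition max_sparsity (I : instance) : nat :=
  (\max_(1 <= t < (horizon I).+1 | isC I t) sparsity (ccoef I t))%N.

Definition shift (eps : R) (c : vec) (i : 'I_n) : R :=
  eps / (4 * (sparsity c)%:R * c i).

Definition cover_objective (eps : R) (w c x0 x : vec) : R :=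
  \sum_(i | c i != 0)
    w i * ((x i + shift eps c i)
             * ln ((x i + shift eps c i) / (x0 i + shift eps c i))
           - (x i + shift eps c i)).

Definition cover_feasible (c x : vec) : Prop := nonneg x /\ 1 <= dot c x.

(* For zero weights the minimizer need not be unique, so the update is a
   relation: [x] is some minimizer. *)
Definition cover_step (eps : R) (w c x0 x : vec) : Prop :=
  [/\ forall i, c i = 0 -> x i = x0 i,
      cover_feasible c x
    & forall u, cover_feasible c u ->
        cover_objective eps w c x0 x <= cover_objective eps w c x0 u].

Definition pack_objective (w p x0 x : vec) : R :=
  \sum_(i | p i != 0) w i * (x i * ln (x i / x0 i) - x i).

(* By the usual convention a * log (a / 0) is 0 for a = 0 and +oo for a > 0,
   whereas here [ln (a / 0) = 0]; the last clause restricts the minimization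
   to the effective domain of the relative entropy. At [x i = 0] the library
   values already agree with 0 * log 0 = 0. *)
Definition pack_feasible (eps : R) (p x0 x : vec) : Prop :=
  [/\ nonneg x,
      dot p x <= 1 + eps
    & forall i, p i != 0 -> x0 i = 0 -> x i = 0].

Definition pack_step (eps : R) (w p x0 x : vec) : Prop :=
  [/\ forall i, p i = 0 -> x i = x0 i,
      pack_feasible eps p x0 x
    & forall u, pack_feasible eps p x0 u ->
        pack_objective w p x0 x <= pack_objective w p x0 u].

(* [x t] is the iterate x^t, for t = 0, ..., T. *)
Definition algorithm_run (eps : R) (I : instance) (x : nat -> vec) : Prop :=
  [/\ forall i, x 0%N i = 0,
      forall t, is_time I t -> isC I t ->
        dot (ccoef I t) (x t.-1) < 1 /\
        cover_step eps (weight I) (ccoef I t) (x t.-1) (x t)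
    & forall t, is_time I t -> isP I t ->
        dot (pcoef I t) (x t.-1) > 1 + eps /\
        pack_step eps (weight I) (pcoef I t) (x t.-1) (x t)].

Definition upward_recourse (I : instance) (x : nat -> vec) : R :=
  \sum_(1 <= t < (horizon I).+1) \sum_i
    weight I i * Num.max 0 (x t i - x t.-1 i).

Definition dual_feasible (I : instance) (y z : nat -> R) (r : nat -> vec) :
    Prop :=
  [/\ forall t, is_time I t -> isC I t -> 0 <= y t,
      forall t, is_time I t -> isP I t -> 0 <= z t,
      forall t i, is_time I t -> isC I t ->
        ccoef I t i * y t - r t i + r t.+1 i <= 0,
      forall t i, is_time I t -> isP I t ->
        - (pcoef I t i * z t) - r t i + r t.+1 i <= 0
    & forall t i, (1 <= t <= (horizon I).+1)%N ->
        0 <= r t i <= weight I i].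

Definition dual_objective (I : instance) (y z : nat -> R) : R :=
  \sum_(1 <= t < (horizon I).+1 | isC I t) y t
  - \sum_(1 <= t < (horizon I).+1 | isP I t) z t.

Definition dual_opt (I : instance) : \bar R :=
  ereal_sup [set v | exists y z r,
    dual_feasible I y z r /\ v = (dual_objective I y z)%:E].

End HalfspaceChasing.

Arguments vec : clear implicits.
Arguments instance : clear implicits.

(* Main.v *)
Require Import Defs.
From mathcomp Require Import all_boot all_order all_algebra.
From mathcomp Require Import all_classical all_reals all_analysis.
From mathcomp Require Import ring lra.

(* The optimality conditions of the steps give multipliers y (cover) and z
   (pack). They satisfy: recourse <= (1 + eps/4) sum y, and (1 + eps) sum z is
   at most the downward movement, hence at most the recourse. So sum y - sum z
   is at least of order eps times the recourse, and it remains to turn (y, z),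
   divided by a logarithm, into a dual solution.

   The cover multiplier increases c_i y by at most w_i times the increase of
   log x_i, and -p_i z is w_i times its decrease; but log x_i has unbounded
   range. For a coordinate x define backwards in time the mark m^T = eta x^T,
   m^t = max(eta x^t, min(x^t, m^(t+1))), where eta = eps^2 / (64 d). Then
   log (x^t / m^t) lies in [0, log (1/eta)], and r_i = w_i (1 - log (x/m) /
   log (1/eta)) is feasible once y^t is decreased by
   (4 d / eps) sum_i w_i (m_i^t - x_i^(t-1))_+. Since m moves down in backward
   time by each such amount and up by at most eta times the downward movement
   of x, these decreases sum to at most (4 d eta / eps) = eps/16 times the
   recourse. *)

Set Implicit Arguments.
Unset Strict Implicit.
Unset Printing Implicit Defensive.

Import Order.TTheory GRing.Theory Num.Theory.
Local Open Scope ring_scope.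

(** * First-order calculus for the entropy objectives *)

Section Slopes.
Context {R : realType}.
Implicit Types (F G : R -> R) (x y g h a b : R).

Lemma ln_leB1 x : 0 < x -> ln x <= x - 1.
Proof.
move=> x0; have := @le_ln1Dx R (x - 1).
have -> : 1 + (x - 1) = x by ring.
by apply; rewrite ltrBDl addrN.
Qed.

(* A one-sided replacement for the derivative: the second-order remainder is
   explicit, so first-order optimality conditions need no limits. *)
Definition slope F x g := exists2 K : R, 0 <= K &
  forall u, 0 <= u -> F u - F x <= g * (u - x) + K * (u - x) ^+ 2.

(** With [a = u + s] and [b = x + s], the increment minus its linear part is
    [w * (a * ln (a / b) - (a - b))], and [ln v <= v - 1] bounds it by [w * (a - b) ^+ 2 / b]. *)
Lemma entropy_slope w s x0 x : 0 <= w -> 0 <= s -> 0 < x + s -> 0 < x0 + s ->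
  slope (fun v => w * ((v + s) * ln ((v + s) / (x0 + s)) - (v + s)))
    x (w * ln ((x + s) / (x0 + s))).
Proof.
move=> w0 s0; set b := x + s; set e := x0 + s => b0 e0.
exists (w / b) => [|u u0 /=]; first by rewrite divr_ge0 // ltW.
rewrite -/b.
have -> : u - x = (u + s) - b by rewrite /b; ring.
set a := u + s; have a0 : 0 <= a by rewrite addr_ge0.
clearbody a b e.
have -> : w * (a * ln (a / e) - a) - w * (b * ln (b / e) - b) =
   w * ((a * ln (a / e) - a) - (b * ln (b / e) - b)) by ring.
have -> : w * ln (b / e) * (a - b) + w / b * (a - b) ^+ 2 =
   w * (ln (b / e) * (a - b) + (a - b) ^+ 2 / b) by ring.
apply: ler_wpM2l => //.
have [->|an0] := eqVneq a 0.
  have -> : (0 - b) ^+ 2 / b = b by field; rewrite gt_eqF.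
  lra.
have {an0}a0 : 0 < a by rewrite lt0r an0.
have ab : a * ln (a / b) <= a * (a / b - 1).
  by rewrite ler_pM2l // ln_leB1 // divr_gt0.
have -> : (a - b) ^+ 2 / b = a * (a / b - 1) - (a - b).
  by field; rewrite gt_eqF.
move: ab; rewrite !ln_div ?posrE // => ab.
lra.
Qed.

Lemma entropy0_slope w x0 x : 0 <= w -> 0 < x -> 0 < x0 ->
  slope (fun v => w * (v * ln (v / x0) - v)) x (w * ln (x / x0)).
Proof.
move=> w0 xp x0p; have := @entropy_slope w 0 x0 x w0 (lexx _).
rewrite !addr0 => /(_ xp x0p) [K K0 H]; exists K => // u u0 /=.
by have := H u u0; rewrite !addr0.
Qed.

Lemma ge0_of_quadratic a b t0 : 0 < t0 ->
  (forall t, 0 < t <= t0 -> 0 <= t * a + t ^+ 2 * b) -> 0 <= a.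
Proof.
move=> t0p H; rewrite leNgt; apply/negP => a0.
(* Chosen so that [t * |b| < - a / 2], which keeps [a + t * b] negative. *)
pose t := Num.min t0 (- a / (2 * (1 + `|b|))).
have b0 := normr_ge0 b.
have b1 := ler_norm b.
have bp : 0 < 2 * (1 + `|b|) by lra.
have tp : 0 < t by rewrite lt_min t0p divr_gt0 // oppr_gt0.
have := H t; rewrite tp ge_min lexx => /(_ isT).
have -> : t * a + t ^+ 2 * b = t * (a + t * b) by ring.
rewrite pmulr_rge0 //.
have : t <= - a / (2 * (1 + `|b|)) by rewrite ge_min lexx orbT.
rewrite ler_pdivlMr // => ht.
have : t * b <= t * `|b| by rewrite ler_pM2l.
lra.
Qed.

(** The slope bounds make the nonnegative increment at most [t * (a * g + b * h)] plus a term of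
    order [t ^+ 2], so the linear coefficient cannot be negative. *)
Lemma slope_exchange F G x y g h a b t0 :
  slope F x g -> slope G y h -> 0 < t0 ->
  (forall t, 0 < t <= t0 -> [/\ 0 <= x + t * a, 0 <= y + t * b &
     0 <= (F (x + t * a) - F x) + (G (y + t * b) - G y)]) ->
  0 <= a * g + b * h.
Proof.
move=> [K K0 HF] [L L0 HG] t0p H.
apply: (@ge0_of_quadratic _ (K * a ^+ 2 + L * b ^+ 2) t0) => // t ht.
have [xa yb D] := H t ht.
have := HF _ xa; have := HG _ yb.
have -> : x + t * a - x = t * a by ring.
have -> : y + t * b - y = t * b by ring.
move=> A B.
have -> : t * (a * g + b * h) + t ^+ 2 * (K * a ^+ 2 + L * b ^+ 2) =
  (g * (t * a) + K * (t * a) ^+ 2) + (h * (t * b) + L * (t * b) ^+ 2) by ring.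
lra.
Qed.

Lemma slope_ge0 F x g a t0 : slope F x g -> 0 < t0 ->
  (forall t, 0 < t <= t0 ->
     0 <= x + t * a /\ 0 <= F (x + t * a) - F x) -> 0 <= a * g.
Proof.
move=> HF t0p H.
have S0 : slope (fun=> 0) 0 0 by exists 0 => // u _; rewrite subrr !mul0r addr0.
have := @slope_exchange _ _ _ _ _ _ a 0 t0 HF S0 t0p.
rewrite mul0r addr0; apply => t /H [H1 H2]; split=> //.
  by rewrite mulr0 addr0.
by rewrite subrr addr0.
Qed.

(* The entropy has slope -oo at 0. *)
Lemma entropy_exchange_at0 w x0 a b G y h t0 :
  0 < w -> 0 < x0 -> 0 < a -> slope G y h -> 0 < t0 ->
  (forall t, 0 < t <= t0 -> 0 <= y + t * b /\
     0 <= w * (t * a * ln (t * a / x0) - t * a) + (G (y + t * b) - G y)) ->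
  False.
Proof.
move=> w0 x0p a0 [L L0 HG] t0p H.
pose D := `|b * h| + L * b ^+ 2.
have D0 : 0 <= D by rewrite addr_ge0 // mulr_ge0 // sqr_ge0.
have wa : 0 < w * a by rewrite mulr_gt0.
(* The exponential bound makes [w * a * ln (t * a / x0) <= - D]. Since [t <= 1], [D] absorbs all
   contributions of [G], and the leftover [- w * a] is negative. *)
pose t := Num.min t0 (Num.min 1 (expR (- (D / (w * a))) * (x0 / a))).
have tp : 0 < t by rewrite !lt_min t0p ltr01 mulr_gt0 ?expR_gt0 // divr_gt0.
have t1 : t <= 1 by rewrite !ge_min lexx orbT.
have te : t <= expR (- (D / (w * a))) * (x0 / a).
  by rewrite !ge_min lexx !orbT.
have := H t; rewrite tp ge_min lexx => /(_ isT) [yb].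
have := HG _ yb.
have -> : y + t * b - y = t * b by ring.
have : ln (t * a / x0) <= - (D / (w * a)).
  rewrite -[leRHS]expRK ler_ln ?posrE ?expR_gt0 ?divr_gt0 ?mulr_gt0 //.
  rewrite ler_pdivrMr // -ler_pdivlMr //.
  by rewrite mulrA in te.
move=> l1 G1 G2.
have l2 : w * a * ln (t * a / x0) <= - D.
  apply: le_trans (ler_wpM2l (ltW wa) l1) _.
  by rewrite mulrN mulrC divfK // gt_eqF.
have : 0 <= t * (w * a * ln (t * a / x0) - w * a + b * h + t * (L * b ^+ 2)).
  have -> : t * (w * a * ln (t * a / x0) - w * a + b * h + t * (L * b ^+ 2)) =
    w * (t * a * ln (t * a / x0) - t * a) + (h * (t * b) + L * (t * b) ^+ 2) by ring.
  lra.
rewrite pmulr_rge0 //.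
have : t * (L * b ^+ 2) <= L * b ^+ 2.
  by rewrite ler_piMl // mulr_ge0 // sqr_ge0.
have := ler_norm (b * h).
rewrite /D in l2; lra.
Qed.

End Slopes.

(** * Multipliers and complementary slackness for single steps *)

Section OptimalityConditions.
Context {R : realType} {n : nat}.
Implicit Types (eps : R) (w c p x u : vec R n) (i j k : 'I_n).

Definition upd x j (a : R) : vec R n := fun i => if i == j then a else x i.

Lemma upd_eq x j a : upd x j a j = a.
Proof. by rewrite /upd eqxx. Qed.

Lemma upd_neq x j a i : i != j -> upd x j a i = x i.
Proof. by rewrite /upd => /negbTE ->. Qed.

Lemma sum_upd (P : pred 'I_n) (F : 'I_n -> R -> R) x j a : P j ->
  \sum_(i | P i) F i (upd x j a i) =
  \sum_(i | P i) F i (x i) + (F j a - F j (x j)).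
Proof.
move=> Pj; rewrite (bigD1 j) // [in RHS](bigD1 j) //= upd_eq.
rewrite (eq_bigr (fun i => F i (x i))); last first.
  by move=> i /andP[_ ij]; rewrite upd_neq.
by ring.
Qed.

Lemma dot_upd c x j a : dot c (upd x j a) = dot c x + c j * (a - x j).
Proof. by rewrite /dot (@sum_upd xpredT (fun i v => c i * v)) // mulrBr. Qed.

Lemma dot_gt0_ex c x : nonneg c -> nonneg x -> 0 < dot c x ->
  exists2 k, c k != 0 & 0 < x k.
Proof.
move=> c0 x0; have [[k ck xk] _|H] := pselect (exists2 k, c k != 0 & 0 < x k).
  by exists k.
rewrite /dot big1 ?ltxx // => i _.
have [->|ci] := eqVneq (c i) 0; first by rewrite mul0r.
have [->|xi] := eqVneq (x i) 0; first by rewrite mulr0.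
by case: H; exists i => //; rewrite lt0r xi x0.
Qed.

Lemma nonneg_upd x j a : nonneg x -> 0 <= a -> nonneg (upd x j a).
Proof. by move=> x0 a0 i; rewrite /upd; case: ifP. Qed.

Lemma sparsity_gt0 c j : c j != 0 -> (0 < sparsity c)%N.
Proof. by move=> cj; apply/card_gt0P; exists j; rewrite inE. Qed.

Lemma shift_gt0 eps c j : 0 < eps -> nonneg c -> c j != 0 -> 0 < Defs.shift eps c j.
Proof.
move=> e0 c0 cj; have c1 : 0 < c j by rewrite lt0r cj c0.
have s1 : 0 < (sparsity c)%:R :> R by rewrite ltr0n (sparsity_gt0 cj).
by rewrite divr_gt0 // mulr_gt0 // mulr_gt0.
Qed.

(** Exchanging mass between two support coordinates forces the ratios [g i / c i] to agree wherever
    [x] is positive; this common ratio is the multiplier. *)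
Lemma cover_multiplier eps w c x0 x :
  0 < eps -> nonneg w -> nonneg c -> nonneg x0 -> cover_step eps w c x0 x ->
  exists y : R, [/\ 0 <= y,
    forall i, c i * y =
      w i * ln ((x i + Defs.shift eps c i) / (x0 i + Defs.shift eps c i)),
    y * dot c x = y & forall i, 0 < w i -> x0 i <= x i].
Proof.
move=> e0 w0 c0 x00 [xfix [xp xc] xopt].
pose s := Defs.shift eps c; pose g i := w i * ln ((x i + s i) / (x0 i + s i)).
pose F i v := w i * ((v + s i) * ln ((v + s i) / (x0 i + s i)) - (v + s i)).
have sp i : c i != 0 -> 0 < s i by move=> ?; apply: shift_gt0.
have cp i : c i != 0 -> 0 < c i by move=> ci; rewrite lt0r ci c0.
have HF i : c i != 0 -> slope (F i) (x i) (g i).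
  move=> ci; have := sp _ ci; have := xp i; have := x00 i => *.
  by apply: entropy_slope; rewrite ?w0 //; lra.
have objE u : cover_objective eps w c x0 u = \sum_(i | c i != 0) F i (u i) by [].
have opt1 j a : c j != 0 -> 0 <= a -> 1 <= dot c x + c j * (a - x j) ->
    0 <= F j a - F j (x j).
  move=> cj a0 ha; have := xopt (upd x j a).
  rewrite !objE (@sum_upd (fun i => c i != 0) F) // lerDl; apply.
  by split; [exact: nonneg_upd|rewrite dot_upd].
have opt2 j k a b : c j != 0 -> c k != 0 -> j != k -> 0 <= a -> 0 <= b ->
    1 <= dot c x + c j * (a - x j) + c k * (b - x k) ->
    0 <= (F j a - F j (x j)) + (F k b - F k (x k)).
  move=> cj ck jk a0 b0 ha; have := xopt (upd (upd x j a) k b).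
  rewrite !objE !(@sum_upd (fun i => c i != 0) F) // upd_neq 1?eq_sym //.
  rewrite -addrA lerDl; apply.
  split; first by do 2?apply: nonneg_upd.
  by rewrite !dot_upd upd_neq 1?eq_sym.
have g0 j : c j != 0 -> 0 <= g j.
  move=> cj; rewrite -[g j]mul1r; apply: (slope_ge0 (HF _ cj) ltr01) => t /andP[t0 _].
  have xt : 0 <= x j + t * 1 by rewrite mulr1 addr_ge0 // ltW.
  split=> //; apply: opt1 => //.
  have -> : x j + t * 1 - x j = t by ring.
  by rewrite (le_trans xc) // lerDl mulr_ge0 // ltW // cp.
have [|k ck xk] := @dot_gt0_ex c x c0 xp; first by rewrite (lt_le_trans ltr01).
pose y := g k / c k.
have y0 : 0 <= y by rewrite divr_ge0 ?g0.
(* The direction [1 / c i], [- 1 / c j] keeps [dot c x] fixed, and [0 < x j] leaves room for short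
   steps. *)
have exch i j : c i != 0 -> c j != 0 -> 0 < x j -> g j / c j <= g i / c i.
  move=> ci cj xj; have [->//|ij] := eqVneq i j.
  have cip := cp _ ci; have cjp := cp _ cj.
  have := @slope_exchange _ _ _ _ _ _ _ (c i)^-1 (- (c j)^-1) (x j * c j)
    (HF _ ci) (HF _ cj).
  rewrite mulNr subr_ge0 ![_^-1 * _]mulrC; apply; first by rewrite mulr_gt0.
  move=> t /andP[t0 tj].
  have A : 0 <= x i + t * (c i)^-1 by rewrite addr_ge0 // divr_ge0 // ltW.
  have B : 0 <= x j + t * - (c j)^-1.
    by rewrite mulrN subr_ge0 ler_pdivrMr.
  split=> //; apply: opt2 => //.
  have -> : dot c x + c i * (x i + t * (c i)^-1 - x i) +
    c j * (x j + t * - (c j)^-1 - x j) = dot c x by field; rewrite ci cj.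
  by [].
have ge i : c i * y = g i.
  have [ci|ci] := eqVneq (c i) 0.
    (* Off the support the shift is [eps / 0 = 0], and [ln 0 = 0] covers [x0 i = 0]. *)
    rewrite ci mul0r /g /s /Defs.shift ci mulr0 invr0 mulr0 !addr0 xfix //.
    have [->|xi] := eqVneq (x0 i) 0; first by rewrite mul0r ln0 // mulr0.
    by rewrite divff // ln1 mulr0.
  have cip := cp _ ci.
  have le1 : c i * y <= g i by rewrite mulrC -ler_pdivlMr // exch.
  apply/eqP; rewrite eq_le le1 /=.
  have [xi|xi] := ltP 0 (x i); first by rewrite mulrC -ler_pdivrMr // exch.
  (* At [x i = 0] the logarithm is nonpositive because [x0 i] is nonnegative. *)
  apply: (@le_trans _ _ 0); last by rewrite mulr_ge0.
  rewrite /g mulr_ge0_le0 // ln_le0 // ler_pdivrMr ?mul1r.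
    by rewrite lerD2r (le_trans xi).
  by rewrite ltr_wpDl // sp.
exists y; split=> // [|i wi].
  have [xc1|xc1] := leP (dot c x) 1.
    have -> : dot c x = 1 by apply/eqP; rewrite eq_le xc xc1.
    by rewrite mulr1.
  (* A slack constraint allows lowering [x k] a little, so [g k <= 0]. *)
  suff -> : y = 0 by rewrite mul0r.
  apply/eqP; rewrite eq_le y0 andbT /y.
  suff : 0 <= -1 * g k by rewrite mulN1r oppr_ge0 => gk; rewrite mulr_le0_ge0 // invr_ge0.
  have ckp := cp _ ck.
  apply: (@slope_ge0 _ _ _ _ _ (Num.min (x k) ((dot c x - 1) / c k)) (HF _ ck)).
    by rewrite lt_min xk divr_gt0 // subr_gt0.
  move=> t /andP[t0]; rewrite le_min => /andP[tx tc].
  have A : 0 <= x k + t * -1 by rewrite mulrN1 subr_ge0.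
  split=> //; apply: opt1 => //.
  move: tc; rewrite ler_pdivlMr // => tc.
  have -> : c k * (x k + t * -1 - x k) = - (t * c k) by ring.
  lra.
have [ci|ci] := eqVneq (c i) 0; first by rewrite xfix.
have si := sp _ ci.
have : 0 <= w i * ln ((x i + s i) / (x0 i + s i)) by rewrite -/(g i) -ge mulr_ge0.
rewrite pmulr_rge0 // => h.
rewrite leNgt; apply/negP => xlt.
have p0 := xp i; have p1 := x00 i.
have : ln ((x i + s i) / (x0 i + s i)) < 0.
  have b0 : 0 < x0 i + s i by lra.
  have a0 : 0 < x i + s i by lra.
  apply: ln_lt0; rewrite divr_gt0 //= ltr_pdivrMr // mul1r.
  lra.
lra.
Qed.

(** The exchange argument of the covering case with reversed signs: mass may always be removed, so
    slopes are nonpositive. The entropy is unshifted and has no finite slope at 0, hence the formula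
    is stated for positive coordinates. *)
Lemma pack_multiplier eps w p x0 x :
  0 < eps -> nonneg w -> nonneg p -> nonneg x0 -> pack_step eps w p x0 x ->
  exists z : R, [/\ 0 <= z,
    forall i, 0 < x i -> p i * z = w i * ln (x0 i / x i),
    z * dot p x = z * (1 + eps) & forall i, 0 < w i -> 0 < x0 i -> 0 < x i].
Proof.
move=> e0 w0 p0 x00 [xfix [xp xc xdom] xopt].
pose g i := w i * ln (x i / x0 i).
pose F i v := w i * (v * ln (v / x0 i) - v).
have pp i : p i != 0 -> 0 < p i by move=> ?; rewrite lt0r p0 andbT.
have x0p i : p i != 0 -> 0 < x i -> 0 < x0 i.
  move=> pi xi; rewrite lt0r x00 andbT; apply/eqP => x0i.
  by move: xi; rewrite xdom // ltxx.
have HF i : p i != 0 -> 0 < x i -> slope (F i) (x i) (g i).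
  by move=> pi xi; apply: entropy0_slope => //; apply: x0p.
have objE u : pack_objective w p x0 u = \sum_(i | p i != 0) F i (u i) by [].
have dom_upd u j a : (forall i, p i != 0 -> x0 i = 0 -> u i = 0) -> 0 < x0 j ->
    forall i, p i != 0 -> x0 i = 0 -> upd u j a i = 0.
  move=> hu xj i pi xi; rewrite upd_neq ?hu //.
  by apply/eqP => ij; move: xj; rewrite -ij xi ltxx.
have opt1 j a : p j != 0 -> 0 < x0 j -> 0 <= a ->
    dot p x + p j * (a - x j) <= 1 + eps -> 0 <= F j a - F j (x j).
  move=> pj xj a0 ha; have := xopt (upd x j a).
  rewrite !objE (@sum_upd (fun i => p i != 0) F) // lerDl; apply.
  by split; [exact: nonneg_upd|rewrite dot_upd|apply: dom_upd].
have opt2 j k a b : p j != 0 -> p k != 0 -> 0 < x0 j -> 0 < x0 k -> j != k ->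
    0 <= a -> 0 <= b ->
    dot p x + p j * (a - x j) + p k * (b - x k) <= 1 + eps ->
    0 <= (F j a - F j (x j)) + (F k b - F k (x k)).
  move=> pj pk xj xk jk a0 b0 ha; have := xopt (upd (upd x j a) k b).
  rewrite !objE !(@sum_upd (fun i => p i != 0) F) // upd_neq 1?eq_sym //.
  rewrite -addrA lerDl; apply.
  split; first by do 2?apply: nonneg_upd.
    by rewrite !dot_upd upd_neq 1?eq_sym.
  by apply: (dom_upd) => //; apply: dom_upd.
have g0 j : p j != 0 -> 0 < x j -> g j <= 0.
  move=> pj xj; rewrite -oppr_ge0 -mulN1r.
  apply: (slope_ge0 (HF _ pj xj) xj) => t /andP[t0 tx].
  have A : 0 <= x j + t * -1 by rewrite mulrN1 subr_ge0.
  split=> //; apply: opt1 => //; first exact: x0p.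
  apply: le_trans xc; rewrite gerDl mulr_ge0_le0 //.
  have -> : x j + t * -1 - x j = - t by ring.
  by rewrite oppr_le0 ltW.
have exF i j t : p i != 0 -> p j != 0 -> 0 < x0 i -> 0 < x0 j -> i != j ->
    0 < t <= x j * p j ->
    [/\ 0 <= x i + t * (p i)^-1, 0 <= x j + t * - (p j)^-1 &
     0 <= (F i (x i + t * (p i)^-1) - F i (x i)) +
          (F j (x j + t * - (p j)^-1) - F j (x j))].
  move=> pi pj xi xj ij /andP[t0 tj].
  have pip := pp _ pi; have pjp := pp _ pj.
  have A : 0 <= x i + t * (p i)^-1 by rewrite addr_ge0 // divr_ge0 // ltW.
  have B : 0 <= x j + t * - (p j)^-1.
    by rewrite mulrN subr_ge0 ler_pdivrMr.
  split=> //; apply: opt2 => //.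
  have -> : dot p x + p i * (x i + t * (p i)^-1 - x i) +
    p j * (x j + t * - (p j)^-1 - x j) = dot p x by field; rewrite pi pj.
  by [].
have slack j : p j != 0 -> 0 < x0 j -> dot p x < 1 + eps ->
    exists2 t0, 0 < t0 & forall t, 0 < t <= t0 ->
     0 <= x j + t * 1 /\ 0 <= F j (x j + t * 1) - F j (x j).
  move=> pj xj dx; have pjp := pp _ pj.
  exists ((1 + eps - dot p x) / p j); first by rewrite divr_gt0 // subr_gt0.
  move=> t /andP[t0]; rewrite ler_pdivlMr // => tj.
  have A : 0 <= x j + t * 1 by rewrite mulr1 addr_ge0 // ltW.
  split=> //; apply: opt1 => //.
  have -> : p j * (x j + t * 1 - x j) = t * p j by ring.
  lra.
have F0 j t : x j = 0 -> F j (x j + t) - F j (x j) =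
    w j * (t * ln (t / x0 j) - t).
  by move=> ->; rewrite /F add0r !mul0r subrr mulr0 subr0.
have tight_ex : 1 + eps <= dot p x -> exists2 k, p k != 0 & 0 < x k.
  by move=> h; apply: dot_gt0_ex => //; lra.
(* At 0 the slope is minus infinity, so raising the coordinate would improve the objective; a tight
   constraint is kept by lowering a positive coordinate [k]. *)
have xpos i : 0 < w i -> 0 < x0 i -> 0 < x i.
  move=> wi xi; have [pi|pi] := eqVneq (p i) 0; first by rewrite xfix.
  rewrite lt0r xp andbT; apply/eqP => xi0.
  have [xc1|xc1] := leP (1 + eps) (dot p x).
    have [k pk xk] := tight_ex xc1.
    have ik : i != k by apply/eqP => ik; move: xk; rewrite -ik xi0 ltxx.
    apply: (@entropy_exchange_at0 _ (w i) (x0 i) (p i)^-1 (- (p k)^-1) _ _ _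
      (x k * p k) wi xi _ (HF _ pk xk)).
    - by rewrite invr_gt0 pp.
    - by rewrite mulr_gt0 // pp.
    move=> t ht; have [//|_ B] := exF i k t pi pk xi _ ik ht; first exact: x0p.
    by rewrite F0.
  have [t0 t0p H] := slack i pi xi xc1.
  have S0 : @slope R (fun=> 0) 0 0.
    by exists 0 => // u _; rewrite subrr !mul0r addr0.
  apply: (@entropy_exchange_at0 _ (w i) (x0 i) 1 0 _ _ _ t0 wi xi ltr01 S0 t0p).
  by move=> t /H[_]; rewrite F0 // subrr mulr0 !addr0.
have gE i : 0 < x i -> 0 < x0 i -> - g i = w i * ln (x0 i / x i).
  by move=> xi x0i; rewrite /g !ln_div ?posrE // -mulrN opprB.
have [xc1|xc1] := leP (1 + eps) (dot p x); last first.
  (* With slack, positive support coordinates can also be raised, so their slopes vanish. *)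
  exists 0; split=> // [i xi|]; last by rewrite !mul0r.
  have [pi|pi] := eqVneq (p i) 0.
    by rewrite mulr0 -xfix // divff ?ln1 ?mulr0 // gt_eqF.
  have xi0 := x0p _ pi xi; rewrite mulr0 -gE //.
  have [t0 t0p H] := slack i pi xi0 xc1.
  have := slope_ge0 (HF _ pi xi) t0p H; rewrite mul1r => gi.
  by apply/eqP; rewrite eq_sym oppr_eq0 eq_le gi g0.
have [k pk xk] := tight_ex xc1.
have exch i j : p i != 0 -> p j != 0 -> 0 < x i -> 0 < x j ->
    g j / p j <= g i / p i.
  move=> pi pj xi xj; have [->//|ij] := eqVneq i j.
  have := @slope_exchange _ _ _ _ _ _ _ (p i)^-1 (- (p j)^-1) (x j * p j)
    (HF _ pi xi) (HF _ pj xj).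
  rewrite mulNr subr_ge0 ![_^-1 * _]mulrC; apply; first by rewrite mulr_gt0 // pp.
  by move=> t ht; apply: exF => //; apply: x0p.
exists (- g k / p k); split=> //.
- by rewrite divr_ge0 // oppr_ge0 g0.
- move=> i xi; have [pi|pi] := eqVneq (p i) 0.
    by rewrite pi mul0r -xfix // divff ?ln1 ?mulr0 // gt_eqF.
  rewrite -gE ?x0p // mulNr.
  have -> : g k / p k = g i / p i.
    by apply/eqP; rewrite eq_le !exch.
  by rewrite mulrN mulrC divfK.
- by congr (_ * _); apply/eqP; rewrite eq_le xc1 xc.
Qed.

End OptimalityConditions.

(** * Movement of one step against its multiplier *)

Section StepBounds.
Context {R : realType} {n : nat}.
Implicit Types (eps : R) (w c p x : vec R n) (i : 'I_n).

(** Since [y = y * dot c x], and the shifts add [y * eps / (4 * sparsity c)] per support coordinate,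
    the right side is a sum of terms [w i * a * ln (a / b)] in the shifted values [a], [b] of [x i],
    [x0 i]; each is at least [w i * (a - b)]. *)
Lemma cover_step_bound eps w c x0 x :
  0 < eps -> nonneg w -> nonneg c -> nonneg x0 -> cover_step eps w c x0 x ->
  exists y : R, [/\ 0 <= y,
    forall i, c i * y =
      w i * ln ((x i + Defs.shift eps c i) / (x0 i + Defs.shift eps c i)),
    forall i, 0 < w i -> x0 i <= x i &
    \sum_i w i * Num.max 0 (x i - x0 i) <= (1 + eps / 4) * y].
Proof.
move=> e0 w0 c0 x00 st; have [y [y0 yE ys mon]] := cover_multiplier e0 w0 c0 x00 st.
have [xfix [xp xc] _] := st; exists y; split=> //.
have sp j : c j != 0 -> 0 < Defs.shift eps c j by exact: shift_gt0.
have [k ck _] : exists2 k, c k != 0 & 0 < x k.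
  by apply: dot_gt0_ex => //; apply: lt_le_trans xc.
have d0 : (sparsity c)%:R != 0 :> R.
  by rewrite pnatr_eq0 -lt0n (sparsity_gt0 ck).
have -> : (1 + eps / 4) * y =
    \sum_i (y * (c i * x i) + (if c i != 0 then y * (eps / (4 * (sparsity c)%:R)) else 0)).
  rewrite big_split /= -mulr_sumr -/(dot c x) ys -big_mkcond /= sumr_const.
  have -> : #|[pred i | c i != 0]| = sparsity c by apply: eq_card => i; rewrite !inE.
  by rewrite -mulr_natr; field.
apply: ler_sum => i _.
have [ci|ci] := eqVneq (c i) 0.
  by rewrite xfix // subrr maxxx mulr0 ci mul0r mulr0 addr0.
have [wi|wi] := eqVneq (w i) 0.
  by rewrite wi mul0r /= addr_ge0 ?mulr_ge0 ?c0 ?xp ?invr_ge0 ?ler0n // ltW.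
have wp : 0 < w i by rewrite lt0r wi w0.
have si := sp _ ci; have x0i := x00 i; have xi := xp i.
have -> : y * (c i * x i) + y * (eps / (4 * (sparsity c)%:R)) =
    (x i + Defs.shift eps c i) * (c i * y).
  by rewrite /Defs.shift; field; rewrite d0 ci.
rewrite yE; have /max_idPr -> : 0 <= x i - x0 i by rewrite subr_ge0 mon.
rewrite mulrCA ler_pM2l //.
have a0 : 0 < x i + Defs.shift eps c i by lra.
have b0 : 0 < x0 i + Defs.shift eps c i by lra.
have := ln_leB1 (divr_gt0 b0 a0).
rewrite !ln_div ?posrE // => h.
have := ler_wpM2l (ltW a0) h.
rewrite [X in _ <= X]mulrBr mulrCA divff ?gt_eqF // mulr1.
lra.
Qed.

(** By complementary slackness [(1 + eps) * z] is the sum of [w i * x i * ln (x0 i / x i)] over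
    positive [x i], and [ln v <= v - 1] bounds each term. *)
Lemma pack_step_bound eps w p x0 x :
  0 < eps -> nonneg w -> nonneg p -> nonneg x0 -> pack_step eps w p x0 x ->
  exists z : R, [/\ 0 <= z,
    forall i, 0 < w i -> [/\ x i <= x0 i, 0 < x0 i -> 0 < x i &
      w i * ln (x0 i / x i) <= p i * z] &
    (1 + eps) * z <= \sum_i w i * Num.max 0 (x0 i - x i)].
Proof.
move=> e0 w0 p0 x00 st; have [z [z0 zE zs pos]] := pack_multiplier e0 w0 p0 x00 st.
have [xfix [xp xc xdom] _] := st; exists z.
have x0p i : 0 < x i -> 0 < x0 i.
  move=> xi; have [pi|pi] := eqVneq (p i) 0; first by rewrite -xfix.
  by rewrite lt0r x00 andbT; apply/eqP => /(xdom _ pi) h; rewrite h ltxx in xi.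
split=> // [i wi|].
  split; last 2 first.
  - exact: pos.
  (* At [x i = 0] the quotient and its logarithm are 0 by convention. *)
  - have [xi|xi] := eqVneq (x i) 0.
      by rewrite xi invr0 mulr0 ln0 // mulr0 mulr_ge0.
    by rewrite zE // lt0r xi xp.
  have [->|xi] := eqVneq (x i) 0; first exact: x00.
  have {}xi : 0 < x i by rewrite lt0r xi xp.
  have : 0 <= w i * ln (x0 i / x i) by rewrite -zE // mulr_ge0.
  rewrite pmulr_rge0 // ln_div ?posrE ?x0p // subr_ge0.
  by rewrite ler_ln ?posrE ?x0p.
rewrite mulrC -zs /dot mulr_sumr; apply: ler_sum => i _.
have [->|xi] := eqVneq (x i) 0.
  by rewrite !mulr0 mulr_ge0 // le_max lexx.
have {}xi : 0 < x i by rewrite lt0r xi xp.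
have -> : z * (p i * x i) = (p i * z) * x i by ring.
rewrite zE // -mulrA ler_wpM2l //.
apply: (@le_trans _ _ (x0 i - x i)); last by rewrite le_max lexx orbT.
have := ln_leB1 (divr_gt0 (x0p _ xi) xi).
rewrite -(ler_pM2r xi) mulrBl divfK ?gt_eqF // mul1r.
by [].
Qed.

End StepBounds.

(** * The mark of a single coordinate and the bounded potential [gap] *)

Section Mark.
Context {R : realType}.
Variables (eta : R) (T : nat) (x : nat -> R).

(** [k] counts the steps left until [T], which makes the backward recursion structural. *)
Fixpoint mark_rev k : R :=
  if k is k'.+1 then
    Num.max (eta * x (T - k)) (Num.min (x (T - k)) (mark_rev k'))
  else eta * x T.

(* A level [v <= x t] is at most [mark t] iff the sequence reaches [v / eta]
   at some time [t' >= t] before dropping below [v]. *)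
Definition mark t := mark_rev (T - t).

Lemma markT : mark T = eta * x T.
Proof. by rewrite /mark subnn. Qed.

Lemma markE t : (t < T)%N ->
  mark t = Num.max (eta * x t) (Num.min (x t) (mark t.+1)).
Proof. by move=> tT; rewrite /mark -(subnSK tT) /= (subnSK tT) subKn // ltnW. Qed.

Hypotheses (eta0 : 0 < eta) (eta1 : eta <= 1) (x0 : forall t, (t <= T)%N -> 0 <= x t).

Lemma mark_bounds t : (t <= T)%N -> eta * x t <= mark t <= x t.
Proof.
move=> tT; have ex : eta * x t <= x t by rewrite ler_piMl // x0.
move: tT; rewrite leq_eqVlt => /predU1P[tE|tT].
  by rewrite tE markT lexx -tE.
by rewrite markE // le_max lexx /= ge_max ex ge_min lexx.
Qed.

(** The potential [mark t - eta * x t] is nonnegative at time 0 and vanishes at [T]; its increase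
    over a step pays for the summand up to [eta] times the upward movement. *)
Lemma mark_sum : x 0%N = 0 ->
  \sum_(1 <= t < T.+1) Num.max 0 (mark t - x t.-1) <=
  eta * \sum_(1 <= t < T.+1) Num.max 0 (x t - x t.-1).
Proof.
move=> x00; rewrite !big_add1 /= mulr_sumr.
have : \sum_(0 <= t < T) Num.max 0 (mark t.+1 - x t) <=
  \sum_(0 <= t < T) (eta * Num.max 0 (x t.+1 - x t) +
   ((mark t.+1 - eta * x t.+1) - (mark t - eta * x t))).
  rewrite !big_nat; apply: ler_sum => t /= tT.
  have /andP[lo _] := mark_bounds tT; rewrite (markE tT).
  have h1 : eta * (x t.+1 - x t) <= eta * Num.max 0 (x t.+1 - x t).
    by rewrite ler_pM2l // le_max lexx orbT.
  have h2 : 0 <= eta * Num.max 0 (x t.+1 - x t).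
    by apply: mulr_ge0; [exact: ltW|rewrite le_max lexx].
  rewrite mulrBr in h1.
  have [mx|mx] := leP (x t) (mark t.+1).
    have /max_idPr -> : 0 <= mark t.+1 - x t by rewrite subr_ge0.
    have /max_idPr -> : eta * x t <= x t by rewrite ler_piMl // x0 // ltnW.
    lra.
  have /max_idPl -> : mark t.+1 - x t <= 0 by rewrite subr_le0 ltW.
  by case: (leP (eta * x t) (mark t.+1)) => _; lra.
move/le_trans; apply.
rewrite big_split /= telescope_sumr // markT subrr sub0r gerDl oppr_le0.
by rewrite subr_ge0; have /andP[] := mark_bounds (leq0n T).
Qed.

Definition gap t := ln (x t / mark t).

Lemma gap_bounds t : (t <= T)%N -> 0 <= gap t <= ln (eta^-1).
Proof.
move=> tT; have /andP[a b] := mark_bounds tT.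
have e1 : 1 <= eta^-1 by rewrite invf_ge1.
have := x0 tT; rewrite le0r => /predU1P[xt|xt].
  by rewrite /gap xt mul0r ln0 // lexx ln_ge0.
have mp : 0 < mark t by apply: lt_le_trans a; rewrite mulr_gt0.
rewrite /gap ln_ge0 ?ler_pdivlMr ?mul1r //=.
rewrite ler_ln ?posrE ?divr_gt0 ?invr_gt0 //.
by rewrite ler_pdivrMr // mulrC ler_pdivlMr // mulrC.
Qed.

(** As long as [mark t.+1 <= x t], also [mark t.+1 <= mark t], so [gap] grows by at least the growth
    of [ln x]. *)
Lemma gap_step t : (t < T)%N -> 0 < x t -> 0 < x t.+1 ->
  mark t.+1 <= x t -> ln (x t.+1 / x t) <= gap t.+1 - gap t.
Proof.
move=> tT xt xt1 mx; have /andP[a b] := mark_bounds tT.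
have /andP[c d] := mark_bounds (ltnW tT).
have mp : 0 < mark t by apply: lt_le_trans c; rewrite mulr_gt0.
have mp1 : 0 < mark t.+1 by apply: lt_le_trans a; rewrite mulr_gt0.
have mm : mark t.+1 <= mark t.
  by rewrite (markE tT) le_max le_min lexx mx orbT.
have : ln (mark t.+1) <= ln (mark t) by rewrite ler_ln ?posrE.
rewrite /gap !ln_div ?posrE //; lra.
Qed.

Lemma gap_down t : (t < T)%N -> x t.+1 <= x t -> (0 < x t -> 0 < x t.+1) ->
  - ln (x t / x t.+1) <= gap t.+1 - gap t.
Proof.
move=> tT xx xp; have /andP[a b] := mark_bounds tT.
have := x0 (ltnW tT); rewrite le0r => /predU1P[xt|xt].
  have xt1 : x t.+1 = 0 by apply/eqP; rewrite eq_le x0 // andbT -xt.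
  by rewrite /gap xt xt1 !mul0r subrr ln0 // oppr0.
have xt1 := xp xt.
apply: le_trans (gap_step tT xt xt1 (le_trans b xx)).
by rewrite !ln_div ?posrE // opprB.
Qed.

(** If the mark exceeds [x t], then [gap t = 0] and the shifted logarithm splits at [mark t.+1]: the
    lower part is paid by the discount, the upper part by [gap t.+1]. Otherwise [gap_step] applies,
    as a shift only shrinks the ratio. *)
Lemma gap_up t s : (t < T)%N -> x t <= x t.+1 -> 0 < s ->
  0 <= gap t.+1 - gap t /\
  ln ((x t.+1 + s) / (x t + s)) - Num.max 0 (mark t.+1 - x t) / s
    <= gap t.+1 - gap t.
Proof.
move=> tT xx s0; have /andP[a b] := mark_bounds tT.
have xt0 := x0 (ltnW tT); have xt10 := x0 tT.
have ap : 0 < x t.+1 + s by rewrite ltr_wpDl.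
have bp : 0 < x t + s by rewrite ltr_wpDl.
have [mx|mx] := leP (x t) (mark t.+1).
  have mE : mark t = x t.
    by rewrite markE //; move/min_idPl: mx => ->; apply/max_idPr; rewrite ler_piMl.
  have gt : gap t = 0.
    rewrite /gap mE; have [->|h] := eqVneq (x t) 0; first by rewrite mul0r ln0.
    by rewrite divff // ln1.
  rewrite gt subr0; have /andP[g0 _] := gap_bounds tT; split=> //.
  have /max_idPr -> : 0 <= mark t.+1 - x t by rewrite subr_ge0.
  have mp : 0 < mark t.+1 + s by rewrite ltr_wpDl // (le_trans xt0).
  have h1 : ln ((mark t.+1 + s) / (x t + s)) <= (mark t.+1 - x t) / s.
    apply: le_trans (ln_leB1 (divr_gt0 mp bp)) _.
    have -> : (mark t.+1 + s) / (x t + s) - 1 = (mark t.+1 - x t) / (x t + s).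
      by field; rewrite gt_eqF.
    by rewrite ler_wpM2l ?subr_ge0 // lef_pV2 ?posrE // lerDr.
  have h2 : ln ((x t.+1 + s) / (mark t.+1 + s)) <= gap t.+1.
    move: xt10; rewrite le0r => /predU1P[xt1|xt1].
      have m0 : mark t.+1 = 0 by apply/eqP; rewrite eq_le -{1}xt1 b (le_trans xt0).
      by rewrite /gap m0 xt1 mul0r add0r divff ?gt_eqF // ln1 ln0.
    have mp1 : 0 < mark t.+1 by apply: lt_le_trans a; rewrite mulr_gt0.
    rewrite ler_ln ?posrE ?divr_gt0 // ler_pdivrMr // mulrAC ler_pdivlMr //.
    by rewrite mulrDl mulrDr lerD2l mulrC ler_pM2r.
  by move: h1 h2; rewrite !ln_div ?posrE //; lra.
have xt : 0 < x t.
  by apply: le_lt_trans mx; apply: le_trans a; rewrite mulr_ge0 // ltW.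
have xt1 : 0 < x t.+1 by apply: lt_le_trans xx.
have h := gap_step tT xt xt1 (ltW mx).
have h0 : 0 <= ln (x t.+1 / x t) by rewrite ln_ge0 // ler_pdivlMr // mul1r.
split; first exact: le_trans h.
have /max_idPl -> : mark t.+1 - x t <= 0 by rewrite subr_le0 ltW.
rewrite mul0r subr0; apply: le_trans h.
rewrite ler_ln ?posrE ?divr_gt0 // ler_pdivrMr // mulrAC ler_pdivlMr //.
by rewrite mulrDl mulrDr lerD2l mulrC ler_pM2r.
Qed.

End Mark.

(** * The dual solution built from a run, and its value *)

Section Run.
Context {R : realType} {n : nat}.
Variables (eps : R) (I : instance R n) (x : nat -> vec R n).
Hypotheses (eps01 : 0 < eps <= 1) (wfI : wf_instance I)
  (run : algorithm_run eps I x).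

Let T := horizon I.
Let w := weight I.
Let d : R := (max_sparsity I)%:R.
(* [eta] is chosen so that [4 d / eps * eta = eps / 16]: the total discount
   [loss] then stays below the gap of order [eps] between covering and packing
   prices. *)
Let eta := eps ^+ 2 / (64 * d).
Let B := ln eta^-1.
Let mk i := mark eta T (fun t => x t i).
Let Q i := gap eta T (fun t => x t i).

Lemma iterate_ge0 t : (t <= T)%N -> nonneg (x t).
Proof.
have [x00 hC hP] := run; case: t => [_ i|t tT]; first by rewrite x00.
have it : is_time I t.+1 by [].
have [_ wP _ _] := wfI.
have [iC|iC] := boolP (isC I t.+1); first by have [_ [_ []]] := hC _ it iC.
by have [|_ [_ []]] := hP _ it; rewrite ?wP.
Qed.

(** The first constraint must be a covering one, since the zero vector violates no packing
    constraint; being satisfiable, it has a nonzero coefficient. *)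
Lemma max_sparsity_gt0 : (0 < T)%N -> (0 < max_sparsity I)%N.
Proof.
move=> T0; have [x00 hC hP] := run; have [w0 wP wc _] := wfI.
have it : is_time I 1 by rewrite /is_time T0.
have [iC|iC] := boolP (isC I 1); last first.
  have [|+ _] := hP _ it; first by rewrite wP.
  rewrite /dot big1 => [|i _]; last by rewrite x00 mulr0.
  by move: eps01 => /andP[? ?] ?; exfalso; lra.
have [_ [_ [xp xc] _]] := hC _ it iC.
have [k ck _] : exists2 k, ccoef I 1 k != 0 & 0 < x 1%N k.
  apply: dot_gt0_ex => //; [exact: wc|exact: lt_le_trans xc].
apply: leq_trans (sparsity_gt0 ck) _.
by apply: (@leq_bigmax_seq _ _ _ (fun t => sparsity (ccoef I t))); rewrite ?mem_index_iota.
Qed.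

Lemma sparsity_le t : is_time I t -> isC I t -> (sparsity (ccoef I t) <= max_sparsity I)%N.
Proof.
move=> it iC.
by apply: (@leq_bigmax_seq _ _ _ (fun t => sparsity (ccoef I t))); rewrite ?mem_index_iota.
Qed.

(* The covering price is discounted by the part of the step at levels that a
   later excursion of the same coordinate exceeds by a factor [1 / eta]. *)
Let loss t := 4 * d / eps * \sum_i w i * Num.max 0 (mk i t - x t.-1 i).

(** Vacuous outside C, so that prices can be chosen as a total function of [t]. *)
Definition cover_price t (v : R) := is_time I t -> isC I t ->
  [/\ 0 <= v,
    forall i, ccoef I t i * v =
      w i * ln ((x t i + Defs.shift eps (ccoef I t) i) /
                (x t.-1 i + Defs.shift eps (ccoef I t) i)),
    forall i, 0 < w i -> x t.-1 i <= x t i &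
    \sum_i w i * Num.max 0 (x t i - x t.-1 i) <= (1 + eps / 4) * v].

Definition pack_price t (v : R) := is_time I t -> isP I t ->
  [/\ 0 <= v,
    forall i, 0 < w i -> [/\ x t i <= x t.-1 i, 0 < x t.-1 i -> 0 < x t i &
      w i * ln (x t.-1 i / x t i) <= pcoef I t i * v] &
    (1 + eps) * v <= \sum_i w i * Num.max 0 (x t.-1 i - x t i)].

Lemma is_time_pred t : is_time I t -> (t.-1 <= T)%N.
Proof. by case/andP=> _ /(leq_trans (leq_pred t)). Qed.

Lemma cover_prices_exist : exists y, forall t, cover_price t (y t).
Proof.
have [_ hC _] := run; have [w0 _ wc _] := wfI; have /andP[e0 _] := eps01.
suff /choice[v Hv] : forall t, exists v, cover_price t v by exists v.
move=> t; have [/andP[it iC]|h] := boolP (is_time I t && isC I t).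
  have [_ st] := hC _ it iC.
  have [v Hv] :=
    cover_step_bound e0 w0 (wc _ it iC) (iterate_ge0 (is_time_pred it)) st.
  by exists v.
by exists 0 => it iC; rewrite it iC in h.
Qed.

Lemma pack_prices_exist : exists z, forall t, pack_price t (z t).
Proof.
have [_ _ hP] := run; have [w0 _ _ wp] := wfI; have /andP[e0 _] := eps01.
suff /choice[v Hv] : forall t, exists v, pack_price t v by exists v.
move=> t; have [/andP[it iP]|h] := boolP (is_time I t && isP I t).
  have [_ st] := hP _ it iP.
  have [v Hv] :=
    pack_step_bound e0 w0 (wp _ it iP) (iterate_ge0 (is_time_pred it)) st.
  by exists v.
by exists 0 => it iP; rewrite it iP in h.
Qed.

Hypothesis T0 : (0 < T)%N.

Lemma d_ge1 : 1 <= d.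
Proof. by rewrite ler1n max_sparsity_gt0. Qed.

Lemma eta_bounds : 0 < eta <= 1 / 64.
Proof.
have /andP[e0 e1] := eps01; have d1 := d_ge1.
have dp : 0 < 64 * d by lra.
rewrite divr_gt0 ?exprn_gt0 //= ler_pdivrMr //.
have : eps ^+ 2 <= 1 by rewrite expr_le1 // ltW.
lra.
Qed.

(** [B] is [ln 64 + ln d - 2 * ln eps]; the constant 63 comes from [ln 64 <= 64 - 1]. *)
Lemma B_bounds : 0 < B <= 63 * (1 + ln (d / eps)).
Proof.
have /andP[e0 e1] := eps01; have d1 := d_ge1; have /andP[h0 h1] := eta_bounds.
have dp : 0 < d by lra.
have l1 : 0 <= ln d by rewrite ln_ge0.
have l2 : ln eps <= 0 by rewrite ln_le0.
have l3 : ln 64 <= 64 - 1 :> R by apply: ln_leB1.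
have BE : B = ln 64 + ln d - ln eps *+ 2.
  rewrite /B /eta invf_div ln_div ?posrE ?mulr_gt0 ?exprn_gt0 //.
  by rewrite lnM ?posrE // lnXn.
rewrite [ln (d / eps)]ln_div ?posrE //.
apply/andP; split; last by rewrite BE mulr2n; lra.
rewrite /B lnV ?posrE // oppr_gt0; apply: ln_lt0; rewrite h0 /=; lra.
Qed.

Lemma loss_ge0 t : 0 <= loss t.
Proof.
have /andP[e0 e1] := eps01; have d1 := d_ge1; have [w0 _ _ _] := wfI.
apply: mulr_ge0; first by rewrite divr_ge0 // ?ltW //; lra.
by apply: sumr_ge0 => i _; apply: mulr_ge0; [exact: w0|rewrite le_max lexx].
Qed.

Lemma loss_sum : \sum_(1 <= t < T.+1 | isC I t) loss t <=
  eps / 16 * upward_recourse I x.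
Proof.
have /andP[e0 e1] := eps01; have d1 := d_ge1; have [w0 _ _ _] := wfI.
have /andP[h0 h1] := eta_bounds; have [x00 _ _] := run.
apply: (@le_trans _ _ (\sum_(1 <= t < T.+1) loss t)).
  rewrite big_mkcond; apply: ler_sum => t _; case: ifP => // _; exact: loss_ge0.
rewrite /loss -mulr_sumr exchange_big /=.
have -> : eps / 16 = 4 * d / eps * eta.
  by rewrite /eta; field; apply/andP; split; rewrite gt_eqF //; lra.
rewrite -[leRHS]mulrA ler_wpM2l //; first by rewrite divr_ge0 // ?ltW //; lra.
rewrite /upward_recourse [X in _ <= _ * X]exchange_big mulr_sumr /=; apply: ler_sum => i _.
rewrite -!mulr_sumr mulrCA ler_wpM2l //.
apply: (@mark_sum _ eta T (fun t => x t i)) => //.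
- lra.
- by move=> t /iterate_ge0.
Qed.

Variables (y z : nat -> R).
Hypotheses (Hy : forall t, cover_price t (y t))
  (Hz : forall t, pack_price t (z t)).

Let ybar t := Num.max 0 (y t - loss t) / B.
Let zbar t := z t / B.
(** The index [t.-1] makes [r t.+1 - r t] reflect the change of the gap during step [t]. *)
Let r t : vec R n := fun i => w i * (1 - Q i t.-1 / B).

(** The discount in [gap_up], divided by the shift and weighted, is at most [ccoef I t i * loss t],
    because the sparsity of the constraint is at most [d]. *)
Lemma cover_gap t i : is_time I t -> isC I t ->
  ccoef I t i * Num.max 0 (y t - loss t) <= w i * (Q i t - Q i t.-1).
Proof.
move=> it iC; have [w0 _ wc _] := wfI; have c0 := wc _ it iC.
have [y0 yE mon _] := Hy it iC; have /andP[e0 e1] := eps01.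
have /andP[h0 h1] := eta_bounds; have d1 := d_ge1.
have ymax : Num.max 0 (y t - loss t) <= y t.
  by rewrite ge_max y0 /= gerBl loss_ge0.
have [wi|wi] := eqVneq (w i) 0.
  rewrite wi mul0r; apply: le_trans (ler_wpM2l (c0 i) ymax) _.
  by rewrite yE wi mul0r.
have wp : 0 < w i by rewrite lt0r wi w0.
case: t it iC c0 y0 yE mon ymax => [//|t] /= it iC c0 y0 yE mon ymax.
have tT : (t < T)%N by [].
have xp s : (s <= T)%N -> 0 <= x s i by move=> /iterate_ge0.
have e'1 : eta <= 1 by lra.
have [ci|ci] := eqVneq (ccoef I t.+1 i) 0.
  (* Only monotonicity of the gap matters here; the shift 1 is arbitrary. *)
  rewrite ci mul0r mulr_ge0 ?w0 //.
  by have [] := @gap_up _ eta T (fun t => x t i) h0 e'1 xp t 1 tT (mon i wp) ltr01.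
have si : 0 < Defs.shift eps (ccoef I t.+1) i by apply: shift_gt0.
have [g1 g2] := @gap_up _ eta T (fun t => x t i) h0 e'1 xp t _ tT (mon i wp) si.
have [yl|yl] := leP (y t.+1 - loss t.+1) 0; first by rewrite mulr0 mulr_ge0.
apply: le_trans (ler_wpM2l (w0 i) g2).
rewrite mulrBr yE mulrBr lerD2l lerN2.
set M := Num.max 0 _.
have M0 : 0 <= M by rewrite le_max lexx.
apply: (@le_trans _ _ (ccoef I t.+1 i * (4 * d / eps * (w i * M)))); last first.
  rewrite ler_wpM2l //.
  rewrite /loss ler_wpM2l //; first by rewrite divr_ge0 // ?ltW //; lra.
  rewrite (bigD1 i) //= lerDl; apply: sumr_ge0 => j _.
  by apply: mulr_ge0; [exact: w0|rewrite le_max lexx].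
have -> : w i * (M / Defs.shift eps (ccoef I t.+1) i) =
   (sparsity (ccoef I t.+1))%:R * (4 * ccoef I t.+1 i * (w i * M) / eps).
  rewrite /Defs.shift; field; rewrite ci gt_eqF //= pnatr_eq0 -lt0n.
  by rewrite (sparsity_gt0 ci).
have -> : ccoef I t.+1 i * (4 * d / eps * (w i * M)) =
  d * (4 * ccoef I t.+1 i * (w i * M) / eps) by field; rewrite gt_eqF.
apply: ler_wpM2r.
  rewrite divr_ge0 ?(ltW e0) // mulr_ge0 // ?mulr_ge0 ?w0 //; exact: c0.
by rewrite ler_nat sparsity_le.
Qed.

Lemma pack_gap t i : is_time I t -> isP I t ->
  - (pcoef I t i * z t) <= w i * (Q i t - Q i t.-1).
Proof.
move=> it iP; have [w0 _ _ wp] := wfI; have p0 := wp _ it iP.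
have [z0 zE _] := Hz it iP; have /andP[h0 h1] := eta_bounds.
have [wi|wi] := eqVneq (w i) 0.
  by rewrite wi mul0r oppr_le0 mulr_ge0 // p0.
have {}wi : 0 < w i by rewrite lt0r wi w0.
have [mon pos zi] := zE i wi.
case: t it iP p0 z0 zE mon pos zi => [//|t] /= it iP p0 z0 zE mon pos zi.
have tT : (t < T)%N by [].
have xp s : (s <= T)%N -> 0 <= x s i by move=> /iterate_ge0.
have e'1 : eta <= 1 by lra.
have := @gap_down _ eta T (fun t => x t i) h0 e'1 xp t tT mon pos.
move=> /(ler_wpM2l (w0 i)); apply: le_trans.
by rewrite mulrN lerN2.
Qed.

Lemma scaled_prices_feasible : dual_feasible I ybar zbar r.
Proof.
have /andP[b0 _] := B_bounds; have /andP[h0 h1] := eta_bounds.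
have [w0 _ _ _] := wfI.
split.
- by move=> t it iC; apply: divr_ge0; [rewrite le_max lexx|exact: ltW].
- by move=> t it iP; have [z0 _ _] := Hz it iP; rewrite divr_ge0 // ltW.
- move=> t i it iC; have := cover_gap i it iC.
  rewrite /ybar /r /= => h.
  have -> : ccoef I t i * (Num.max 0 (y t - loss t) / B) -
     w i * (1 - Q i t.-1 / B) + w i * (1 - Q i t / B) =
     (ccoef I t i * Num.max 0 (y t - loss t) - w i * (Q i t - Q i t.-1)) / B.
    by field; rewrite gt_eqF.
  by rewrite ler_pdivrMr // mul0r subr_le0.
- move=> t i it iP; have := pack_gap i it iP.
  rewrite /zbar /r /= => h.
  have -> : - (pcoef I t i * (z t / B)) -
     w i * (1 - Q i t.-1 / B) + w i * (1 - Q i t / B) =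
     (- (pcoef I t i * z t) - w i * (Q i t - Q i t.-1)) / B.
    by field; rewrite gt_eqF.
  by rewrite ler_pdivrMr // mul0r subr_le0.
- move=> [//|t] i /= tT.
  have xp s : (s <= T)%N -> 0 <= x s i by move=> /iterate_ge0.
  have e'1 : eta <= 1 by lra.
  have /andP[q0 q1] := @gap_bounds _ eta T (fun t => x t i) h0 e'1 xp t tT.
  have a0 : 0 <= Q i t / B by rewrite divr_ge0 // ltW.
  have a1 : Q i t / B <= 1 by rewrite ler_pdivrMr // mul1r.
  by rewrite mulr_ge0 ?w0 ?subr_ge0 //= ler_piMr ?w0 // gerBl.
Qed.

Lemma recourse_le_scaled_objective :
  upward_recourse I x <= 315 * (eps^-1 * (1 + ln (d / eps))) * dual_objective I ybar zbar.
Proof.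
have /andP[b0 b1] := B_bounds; have [w0 wP _ _] := wfI; have [x00 _ _] := run.
have /andP[e0 e1] := eps01.
pose U := upward_recourse I x.
pose up t := \sum_i w i * Num.max 0 (x t i - x t.-1 i).
pose down t := \sum_i w i * Num.max 0 (x t.-1 i - x t i).
have up0 t : 0 <= up t.
  by apply: sumr_ge0 => i _; apply: mulr_ge0; [exact: w0|rewrite le_max lexx].
have down0 t : 0 <= down t.
  by apply: sumr_ge0 => i _; apply: mulr_ge0; [exact: w0|rewrite le_max lexx].
have U0 : 0 <= U by apply: sumr_ge0 => t _; exact: up0.
have UY : U <= (1 + eps / 4) * \sum_(1 <= t < T.+1 | isC I t) y t.
  rewrite mulr_sumr big_mkcond /U /upward_recourse !big_nat.
  apply: ler_sum => t it; case: ifP => iC; first by have [_ _ _] := Hy it iC.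
  have [|_ zE _] := Hz it; first by rewrite wP // iC.
  rewrite big1 // => i _; have [->|wi] := eqVneq (weight I i) 0; first by rewrite mul0r.
  have [|mon _ _] := zE i; first by rewrite lt0r w0 andbT; exact: wi.
  by move: mon; rewrite -subr_le0 => /max_idPl ->; rewrite mulr0.
(* Upward minus downward movement telescopes to the weighted sum of the final iterate. *)
have DU : \sum_(1 <= t < T.+1) down t <= U.
  rewrite -subr_ge0 /U /upward_recourse -sumrB.
  have -> : \sum_(1 <= t < T.+1) (up t - down t) =
     \sum_(0 <= t < T) (\sum_i w i * x t.+1 i - \sum_i w i * x t i).
    rewrite big_add1 /=; apply: eq_bigr => t _; rewrite -!sumrB.
    apply: eq_bigr => i _ /=; rewrite -!mulrBr; congr (_ * _).
    have [h|h] := leP (x t.+1 i) (x t i).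
      have /max_idPl -> : x t.+1 i - x t i <= 0 by rewrite subr_le0.
      have /max_idPr -> : 0 <= x t i - x t.+1 i by rewrite subr_ge0.
      by ring.
    have /max_idPr -> : 0 <= x t.+1 i - x t i by rewrite subr_ge0 ltW.
    have /max_idPl -> : x t i - x t.+1 i <= 0 by rewrite subr_le0 ltW.
    by ring.
  rewrite (@telescope_sumr _ 0 T (fun t => \sum_i w i * x t i)) //.
  rewrite [X in _ - X]big1 => [|i _]; last by rewrite x00 mulr0.
  rewrite subr0; apply: sumr_ge0 => i _; apply: mulr_ge0; first exact: w0.
  exact: (iterate_ge0 (leqnn T)).
have ZU : (1 + eps) * \sum_(1 <= t < T.+1 | isP I t) z t <= U.
  apply: le_trans DU; rewrite mulr_sumr big_mkcond !big_nat.
  by apply: ler_sum => t it; case: ifP => // iP; have [_ _] := Hz it iP.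
have Lo := loss_sum.
have YL : \sum_(1 <= t < T.+1 | isC I t) y t - \sum_(1 <= t < T.+1 | isC I t) loss t
   <= \sum_(1 <= t < T.+1 | isC I t) Num.max 0 (y t - loss t).
  by rewrite -sumrB; apply: ler_sum => t _; rewrite le_max lexx orbT.
rewrite /dual_objective /ybar /zbar -!mulr_suml -mulrBl.
rewrite -/T; rewrite -/U in Lo *.
move: UY ZU Lo YL.
set Y := \sum_(_ <= _ < _ | _) y _; set L := \sum_(_ <= _ < _ | _) loss _.
set Z := \sum_(_ <= _ < _ | _) z _; set Ym := \sum_(_ <= _ < _ | _) Num.max _ _.
move=> UY ZU Lo YL.
(* The price gap [1 / (1 + eps / 4) - 1 / (1 + eps)] is at least [eps / 5 + eps / 16]; the losses
   consume [eps / 16]. The remaining [eps / 5] and the 63 of [B_bounds] give 315. *)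
have key : U * (eps / 5) <= Ym - Z.
  have q4 : 0 < 1 + eps / 4 by lra.
  have q1 : 0 < 1 + eps by lra.
  have hY : U / (1 + eps / 4) <= Y by rewrite ler_pdivrMr // mulrC.
  have hZ : Z <= U / (1 + eps) by rewrite ler_pdivlMr // mulrC.
  have : U * (eps / 5 + eps / 16) <= U / (1 + eps / 4) - U / (1 + eps).
    rewrite -mulrBr ler_wpM2l //.
    have -> : (1 + eps / 4)^-1 - (1 + eps)^-1 =
      (3 / 4 * eps) / ((1 + eps / 4) * (1 + eps)).
      by field; apply/andP; split; rewrite gt_eqF //; lra.
    rewrite ler_pdivlMr ?mulr_gt0 //.
    have -> : (eps / 5 + eps / 16) * ((1 + eps / 4) * (1 + eps)) =
      eps * (21 / 80 * ((1 + eps / 4) * (1 + eps))) by field.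
    rewrite [leRHS]mulrC ler_pM2l //.
    have : (1 + eps / 4) * (1 + eps) <= 5 / 4 * 2 by rewrite ler_pM //; lra.
    lra.
  lra.
have K1 : B <= 63 * (1 + ln (d / eps)) by [].
have o0 : 0 <= (Ym - Z) / B.
  apply: divr_ge0; last exact: ltW.
  by apply: le_trans key; rewrite mulr_ge0 // divr_ge0 // ltW.
have -> : 315 * (eps^-1 * (1 + ln (d / eps))) * ((Ym - Z) / B) =
  5 / eps * ((63 * (1 + ln (d / eps))) * ((Ym - Z) / B)).
  by field; rewrite !gt_eqF.
apply: (@le_trans _ _ (5 / eps * (B * ((Ym - Z) / B)))); last first.
  rewrite ler_wpM2l ?ler_wpM2r //; first by rewrite divr_ge0 // ltW.
rewrite [B * _]mulrC divfK ?gt_eqF //.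
have -> : 5 / eps * (Ym - Z) = (Ym - Z) / (eps / 5) by field; rewrite gt_eqF.
by rewrite ler_pdivlMr // divr_gt0.
Qed.

End Run.

(* The constant hidden in O(.) is universal. Literally, log (d / eps) is 0 for
   d = eps = 1, where the bound fails; the O(.) is therefore read with
   1 + log (d / eps), which is at most 3 log (d / eps) as soon as
   d / eps >= 2. *)
Theorem theorem3p6 (R : realType) :
  exists2 K : R, 0 < K &
    forall (n : nat) (eps : R) (I : instance R n) (x : nat -> vec R n),
      0 < eps <= 1 ->
      wf_instance I ->
      algorithm_run eps I x ->
      ((upward_recourse I x)%:E <=
        (K * (eps^-1 * (1 + ln ((max_sparsity I)%:R / eps))))%:E
          * dual_opt I)%E.
Proof.
exists 315 => // n eps I x e01 wfI run.
have /andP[e0 e1] := e01.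
have lnge : 0 <= 1 + ln ((max_sparsity I)%:R / eps).
  have [->|] := eqVneq (max_sparsity I) 0%N.
    by rewrite mul0r ln0 // addr0.
  rewrite -lt0n => d0; rewrite addr_ge0 // ln_ge0 // ler_pdivlMr // mul1r.
  by apply: le_trans e1 _; rewrite ler1n.
have K0 : 0 <= 315 * (eps^-1 * (1 + ln ((max_sparsity I)%:R / eps))).
  by rewrite !mulr_ge0 // invr_ge0 ltW.
suff [y [z [r [feas le]]]] : exists y z r, dual_feasible I y z r /\
   upward_recourse I x <= 315 * (eps^-1 * (1 + ln ((max_sparsity I)%:R / eps))) *
     dual_objective I y z.
  apply: (@le_trans _ _ ((315 * (eps^-1 * (1 + ln ((max_sparsity I)%:R / eps)))) *
     dual_objective I y z)%:E%E); first by rewrite lee_fin.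
  rewrite EFinM lee_wpmul2l ?lee_fin //.
  by apply: ereal_sup_ubound; exists y, z, r.
(* An empty horizon has [d = 0], where [eta] degenerates; the zero dual solution suffices. *)
have [T0|T0] := posnP (horizon I).
  have [w0 _ _ _] := wfI.
  exists (fun=> 0), (fun=> 0), (fun=> fun=> 0); split.
    by split=> // [t i _ _|t i _ _|t i _] /=;
      rewrite ?mulr0 ?oppr0 ?subr0 ?addr0 ?lexx ?w0.
  by rewrite /upward_recourse /dual_objective T0 !big_geq // subrr mulr0.
have [y Hy] := cover_prices_exist e01 wfI run.
have [z Hz] := pack_prices_exist e01 wfI run.
do 3 eexists; split; first exact: (scaled_prices_feasible e01 wfI run T0 Hy Hz).
exact: recourse_le_scaled_objective.
Qed.
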